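(* Let $G$ be a countable group, let $\mathcal{H}$ be a Hilbert space and let $\{ f_g \}_{g \in G}$ be a Bessel sequence in $\mathcal{H}$ with the property that for any $g_1,g_2,h_1,h_2 \in G$ satisfying $g_1g_2^{-1} = h_1h_2^{-1}$ we have $\langle f_{g_1}, f_{g_2} \rangle = \langle f_{h_1},f_{h_2} \rangle$. If $G$ can be partitioned into finitely many subsets $\{ A_l: 1 \le l \le L \}$ such that for $1 \le l \le L$, $\{ f_g: g \in A_l \}$ is a Riesz basic sequence, then $G$ can be partitioned into $K$ syndetic subsets $\{ S_k: 1 \le k \le K \}$ with $K \le L$ such that for $1 \le k \le K$, $\{ f_g: g \in S_k \}$ is a Riesz basic sequence.
   Context: A subset $S \subseteq G$ of a group $G$ is called syndetic if there exists a finite set $F \subseteq G$ such that $G = \bigcup_{g \in F} g^{-1}S$. A family $\{f_i\}_{i \in I}$ in a Hilbert space $\mathcal{H}$ is a Bessel sequence if there is a constant $B>0$ such that $\sum_{i \in I} |\langle x, f_i\rangle|^2 \le B\|x\|^2$ for all $x \in \mathcal{H}$. A family $\{f_i\}_{i\in J}$ (indexed by $J$) is a Riesz basic sequence if there are constants $0<a\le b<\infty$ such that $a \sum_{i} |c_i|^2 \le \| \sum_{i} c_i f_i \|^2 \le b \sum_i |c_i|^2$ for all finitely supported families of scalars $(c_i)_{i \in J}$. *)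

(* Defs.v *)
From mathcomp Require Import all_boot all_order all_algebra.
From mathcomp Require Import complex.
From mathcomp Require Import all_classical all_reals all_analysis.

Set Implicit Arguments.
Unset Strict Implicit.
Unset Printing Implicit Defensive.

Import Order.TTheory GRing.Theory Num.Theory.
Import numFieldNormedType.Exports.

Local Open Scope classical_set_scope.
Local Open Scope ring_scope.

(* Hilbert spaces may be real or complex: the scalar field is R or R[i]. *)
Variant scalar_kind := RealScalars | ComplexScalars.

Definition scalar_field (R : realType) (k : scalar_kind) : numFieldType :=
  match k with
  | RealScalars => R
  | ComplexScalars => R[i]
  end.

Definition scalar_conj (R : realType) (k : scalar_kind) :
    scalar_field R k -> scalar_field R k :=
  match k with
  | RealScalars => idfun
  | ComplexScalars => @Num.conj R[i]
  end.

Definition scalar_Re (R : realType) (k : scalar_kind) : scalar_field R k -> R :=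
  match k with
  | RealScalars => idfun
  | ComplexScalars => @complex.Re R
  end.

(* The norm `|v| of a normed module over R[i] lies in R[i]; it is a real number
   there, and rnorm v is the same number in R. *)
Definition rnorm (R : realType) (k : scalar_kind)
    (V : normedZmodType (scalar_field R k)) (v : V) : R :=
  scalar_Re `|v|.

(* The inner product is linear in its first argument. *)
Record hilbertSpace (R : realType) (k : scalar_kind) := HilbertSpace {
  hilbert_carrier :> completeNormedModType (scalar_field R k);
  inner : {dot hilbert_carrier for @scalar_conj R k};
  inner_norm : forall x : hilbert_carrier, inner x x = `|x| ^+ 2
}.

Definition bessel (R : realType) (k : scalar_kind) (H : hilbertSpace R k)
    (I : choiceType) (f : I -> H) : Prop :=
  exists2 B : R, 0 < B &
    forall x : H,
      (\esum_(i in [set: I]) (rnorm (inner H x (f i)) ^+ 2)%:E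
         <= (B * rnorm x ^+ 2)%:E)%E.

(* The subfamily (f i), i in J, is a Riesz basic sequence: only the values of c
   on J matter. *)
Definition riesz_basic (R : realType) (k : scalar_kind) (H : hilbertSpace R k)
    (I : choiceType) (f : I -> H) (J : set I) : Prop :=
  exists a b : R, [/\ 0 < a, a <= b &
    forall c : I -> scalar_field R k, finite_set [set i | J i /\ c i != 0] ->
      a * (\sum_(i \in J) rnorm (c i) ^+ 2)
        <= rnorm (\sum_(i \in J) (c i *: f i)) ^+ 2
        <= b * (\sum_(i \in J) rnorm (c i) ^+ 2)].

Definition syndetic (G : groupType) (S : set G) : Prop :=
  exists2 F : set G, finite_set F &
    [set: G] = \bigcup_(g in F) [set (g^-1 * s)%g | s in S].

(* Main.v *)
Require Import Defs.
From mathcomp Require Import all_boot all_order all_algebra.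
From mathcomp Require Import finmap complex.
From mathcomp Require Import all_classical all_reals all_analysis.

(** Read the partition as a colouring [x] of [G].  If a colour that occurs in
    [x] is not syndetic, arbitrarily large right translates of [x] avoid it, and
    a limit of these translates along an ultrafilter is a colouring with fewer
    colours, each finite pattern of which is a right translate of a pattern of
    [x].  After finitely many such steps every colour that occurs is syndetic.
    The Gram matrix of [f] is invariant under right translation, so being a
    Riesz basic sequence with given bounds passes from the colour classes of [x]
    to those of the final colouring. *)

Set Implicit Arguments.
Unset Strict Implicit.
Unset Printing Implicit Defensive.

Import GRing.Theory Num.Theory.

(** That is, [y] lies in the closure of the orbit of [x] under right translation, for the product
    topology with [T] discrete. *)
Definition locally_translate (G : groupType) (T : Type) (y x : G -> T) : Prop :=
  forall E : seq G, exists t : G, forall g, g \in E -> y g = x (g * t)%g.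

Lemma locally_translate_refl (G : groupType) (T : Type) (x : G -> T) :
  locally_translate x x.
Proof. by move=> E; exists 1%g => g _; rewrite mulg1. Qed.

Lemma locally_translate_trans (G : groupType) (T : Type) (y x z : G -> T) :
  locally_translate x y -> locally_translate y z -> locally_translate x z.
Proof.
move=> xy yz E; have [t xyt] := xy E.
have [s yzs] := yz [seq (g * t)%g | g <- E].
exists (t * s)%g => g gE; rewrite xyt// mulgA yzs//.
by apply/mapP; exists g.
Qed.

Section coloring.
Local Open Scope classical_set_scope.

(** Otherwise each [s] has some [t] in [F] with [t * s] in [S]; then [s = t^-1 * (t * s)], and [F]
    witnesses that [S] is syndetic. *)
Lemma nsyndetic_avoid (G : groupType) (S : set G) (F : set G) :
  ~ syndetic S -> finite_set F ->
  exists s, forall t, F t -> ~ S (t * s)%g.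
Proof.
move=> nS finF; apply: contrapT => /forallNP avoid; apply: nS.
exists F => //; apply/esym; rewrite -subTset => s _.
have /existsNP[t /not_implyP[Ft /contrapT Sts]] := avoid s.
by exists t => //; exists (t * s)%g => //; rewrite mulKg.
Qed.

Lemma nsyndetic_limit (G : groupType) (C : finType) (x : G -> C) (i : C) :
  ~ syndetic (x @^-1` [set i]) ->
  exists y, locally_translate y x /\ forall g, y g <> i.
Proof.
move=> nS.
(* The translates of [x] by elements of [B F] avoid [i] on [F]. For finite [F] these sets generate a
   proper filter, which extends to an ultrafilter [U]. *)
pose B (F : set G) := [set s | forall t, F t -> x (t * s)%g <> i].
have FB : ProperFilter (filter_from finite_set B).
  apply: filter_from_proper.
    apply: filter_from_filter; first by exists set0; exact: finite_set0.
    move=> F1 F2 fF1 fF2; exists (F1 `|` F2); first by rewrite finite_setU.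
    by move=> s Bs; split=> t Ft; apply: Bs; [left|right].
  by move=> F /(nsyndetic_avoid nS)[s Ps]; exists s => t /Ps.
have [U [UU BU]] := ultraFilterLemma FB.
(* Since [C] is finite, [x (g * s)] has a limit colour as [s] runs along [U]; this limit is
   [y g]. *)
have limP g : exists c, U [set s | x (g * s)%g = c].
  apply: contrapT => /forallNP nU.
  have /filter_ex[s /(_ (x (g * s)%g))] :
      U [set s | forall c, x (g * s)%g <> c]; last exact.
  apply: filter_forall => c.
  by have [/nU|] := in_ultra_setVsetC [set s | x (g * s)%g = c] UU.
have [y yP] := choice limP; exists y; split=> [E|g].
  (* Finitely many members of [U] have a common point [s], and translation by [s] matches [y] on all
     of [E]. *)
  have /filter_ex[s Es] : U (\bigcap_(g in [set` [fset g in E]%fset])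
      [set s | x (g * s)%g = y g]) by apply: filter_bigI => g _; exact: yP.
  by exists s => g gE; apply/esym/Es; rewrite /= inE.
have Ug : U (B [set g]) by apply: BU; exists [set g].
have /filter_ex[s [Bs <-]] : U (B [set g] `&` [set s | x (g * s)%g = y g]).
  exact: filterI.
exact: Bs.
Qed.

Lemma syndetic_coloring (G : groupType) (C : finType) (x : G -> C) :
  exists y, locally_translate y x /\
    forall g, syndetic (y @^-1` [set y g]).
Proof.
(* Induction on the number of colours that occur. *)
pose colors (z : G -> C) := [set i | `[< exists g, z g = i >]]%SET.
have [n] := ubnP #|colors x|; elim: n x => // n IHn x lexn.
have [|/existsNP[g nSg]] := pselect (forall g, syndetic (x @^-1` [set x g])).
  by move=> xS; exists x; split => //; exact: locally_translate_refl.
have [y [yx ny]] := nsyndetic_limit nSg.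
have [|z [zy zS]] := IHn y; last first.
  by exists z; split => //; exact: locally_translate_trans zy yx.
(* Every colour of [y] occurs in [x], by comparison on one-element patterns, while [x g] is lost. *)
rewrite -ltnS; apply: leq_trans lexn; rewrite ltnS.
apply: proper_card; apply/properP; split.
  apply/fintype.subsetP => i; rewrite !inE => -[h <-].
  by have [t yxt] := yx [:: h]; exists (h * t)%g; rewrite yxt ?mem_head.
exists (x g); first by rewrite !inE; exists g.
by apply/negP; rewrite !inE => -[h]; exact: ny.
Qed.

End coloring.

Section riesz.
Local Open Scope classical_set_scope.
Local Open Scope ring_scope.

Lemma inner_lincomb {R : realType} {k : scalar_kind} {H : hilbertSpace R k}
    {I : Type} (r : seq I) (c : I -> scalar_field R k) (f : I -> H) :
  inner H (\sum_(i <- r) c i *: f i) (\sum_(i <- r) c i *: f i) =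
  \sum_(i <- r)
    c i * \sum_(j <- r) @scalar_conj R k (c j) * inner H (f i) (f j).
Proof.
rewrite linear_sumlz; apply: eq_bigr => i _.
rewrite linearZl_LR linear_sumr/=; congr (_ * _).
by apply: eq_bigr => j _; rewrite linearZr_LR.
Qed.

(** The squared norm expands into a double sum in which the vectors enter only through their Gram
    matrix. *)
Lemma eq_gram_norm {R : realType} {k : scalar_kind} {H : hilbertSpace R k}
    {I : Type} (r : seq I) (c : I -> scalar_field R k) (f f' : I -> H) :
  (forall i j, inner H (f i) (f j) = inner H (f' i) (f' j)) ->
  `|\sum_(i <- r) c i *: f i| = `|\sum_(i <- r) c i *: f' i|.
Proof.
move=> ff'; apply/eqP; rewrite -(@eqrXn2 _ 2)// -!inner_norm !inner_lincomb.
apply/eqP/eq_bigr => i _; congr (_ * _); apply: eq_bigr => j _.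
by rewrite ff'.
Qed.

(** Coefficients with finite support in [J'] are moved into [J] by a right translation. This changes
    neither the sum of squares nor, by Gram invariance, the norm, so the bounds [a] and [b]
    persist. *)
Lemma riesz_basic_translate (R : realType) (k : scalar_kind)
    (H : hilbertSpace R k) (G : groupType) (f : G -> H) (J J' : set G) :
  (forall g1 g2 h1 h2 : G, (g1 * g2^-1)%g = (h1 * h2^-1)%g ->
     inner H (f g1) (f g2) = inner H (f h1) (f h2)) ->
  (forall E : seq G, exists t : G,
     forall g, g \in E -> J' g -> J (g * t)%g) ->
  riesz_basic f J -> riesz_basic f J'.
Proof.
move=> gram J'J [a [b [a0 ab rJ]]]; exists a, b; split => // c finc.
pose E := enum_fset (fset_set [set i | J' i /\ c i != 0]).
have EP g : (g \in E) = (`[< J' g >] && (c g != 0)).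
  rewrite [LHS]in_fset_set//; apply/idP/andP => [|[/asboolP ? ?]].
    by rewrite inE => -[? ?]; split => //; exact/asboolP.
  by rewrite inE.
have [t Et] := J'J E.
(* The translate of [c] cut down to its support [E] in [J']. The sums over [J'] and [J] both become
   sums over [E]. *)
pose c' h := if (h * t^-1)%g \in E then c (h * t^-1)%g else 0.
have sumJ' (V : nmodType) (F : G -> V) : (forall g, c g = 0 -> F g = 0) ->
    \sum_(i \in J') F i = \sum_(i <- E) F i.
  move=> F0; rewrite (fsbigE E); first last.
  - move=> g J'g; rewrite EP negb_and negbK => /orP[/asboolP//|/eqP].
    exact: F0.
  - by move=> g /=; rewrite EP => /andP[/asboolP].
  - exact: fset_uniq.
  rewrite big_seq_cond [RHS]big_seq; apply: eq_bigl => g.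
  by rewrite EP; case: asboolP => J'g /=; rewrite ?andbF// mem_set// andbT.
have sumJ (V : nmodType) (F : G -> V) : (forall h, c' h = 0 -> F h = 0) ->
    \sum_(i \in J) F i = \sum_(i <- E) F (i * t)%g.
  move=> F0; rewrite (fsbigE [seq (i * t)%g | i <- E]); first last.
  - move=> h _ /negP hE; apply: F0; rewrite /c'; case: ifPn => // htE.
    by case: hE; apply/mapP; exists (h * t^-1)%g => //; rewrite mulgVK.
  - move=> _ /mapP[g gE ->]; apply: Et => //.
    by move: gE; rewrite EP => /andP[/asboolP].
  - by rewrite map_inj_uniq ?fset_uniq//; exact: mulIg.
  rewrite big_map big_seq_cond [RHS]big_seq; apply: eq_bigl => g.
  apply: andb_idr => gE; apply/mem_set/Et => //.
  by move: gE; rewrite EP => /andP[/asboolP].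
have c'E g : g \in E -> c' (g * t)%g = c g by rewrite /c' mulgK => ->.
have finc' : finite_set [set i | J i /\ c' i != 0].
  apply: (sub_finite_set _ (finite_seq [seq (i * t)%g | i <- E])).
  move=> h [_]; rewrite /c'/=; case: ifPn => [hE _|]; last by rewrite eqxx.
  by apply/mapP; exists (h * t^-1)%g => //; rewrite mulgVK.
have rnorm0X2 : rnorm (0 : scalar_field R k) ^+ 2 = 0.
  by rewrite /rnorm normr0; clear; case: k; rewrite /= expr0n.
have := rJ c' finc'.
rewrite !sumJ ?sumJ'; do ?by move=> ? ->; rewrite ?scale0r.
rewrite (eq_big_seq (fun i => rnorm (c i) ^+ 2)); last first.
  by move=> g gE; rewrite c'E.
rewrite (eq_big_seq (fun i => c i *: f (i * t)%g)); last first.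
  by move=> g gE; rewrite c'E.
rewrite /rnorm.
rewrite (eq_gram_norm _ _ (f := fun i => f (i * t)%g) (f' := f))// => i j.
by apply: gram; rewrite invgM mulgA mulgK.
Qed.

End riesz.

Theorem theorem1p1 (R : realType) (k : scalar_kind) (H : hilbertSpace R k)
    (G : groupType) (f : G -> H) (L : nat) (A : 'I_L -> set G) :
  countable [set: G] ->
  bessel f ->
  (forall g1 g2 h1 h2 : G, (g1 * g2^-1)%g = (h1 * h2^-1)%g ->
     inner H (f g1) (f g2) = inner H (f h1) (f h2)) ->
  partition [set: 'I_L] A [set: G] ->
  (forall l : 'I_L, riesz_basic f (A l)) ->
  exists (K : nat) (S : 'I_K -> set G),
    [/\ (K <= L)%N,
        partition [set: 'I_K] S [set: G],
        forall j : 'I_K, syndetic (S j) &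
        forall j : 'I_K, riesz_basic f (S j)].
Proof.
move=> _ _ gram [covA _ _] rA.
have xP g : exists l, A l g.
  by have : cover [set: 'I_L] A g; [rewrite covA | case=> l; exists l].
have [x Ax] := choice xP.
have [y [yx yS]] := syndetic_coloring x.
pose D := [set i | `[< exists g, y g = i >]]%SET.
have DP i : reflect (exists g, y g = i) (i \in D).
  by rewrite inE; exact: asboolP.
(* Only the colours that [y] takes are enumerated, so no class is empty, and there are at most [L]
   of them. *)
exists #|D|, (fun j => y @^-1` [set enum_val j])%classic; split.
- by rewrite -[leqRHS]card_ord max_card.
- split.
  + rewrite -subTset => g _.
    have gD : y g \in D by apply/DP; exists g.
    by exists (enum_rank_in gD (y g)) => //=; rewrite enum_rankK_in.
  + by move=> i j _ _ [g [/= -> /enum_val_inj]].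
  + by move=> j _; have /DP[g gj] := enum_valP j; exists g.
- by move=> j; have /DP[g <-] := enum_valP j.
- move=> j; apply: (riesz_basic_translate gram _ (rA (enum_val j))) => //.
  (* On [E], [x (g * t) = y g], so [t] carries the points of colour [y g] into the part
     [A (y g)]. *)
  move=> E; have [t yxt] := yx E; exists t => g gE /= <-.
  by rewrite yxt.
Qed.
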